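(* Let $N\subset\mathbb{R}$ be the set of normal numbers (in the sense defined in the context). The set $\mathbb{R}\setminus N$ of non-normal numbers is immeasurable; that is, it is either null or non-$\sigma$-finite for every translation invariant Borel measure on $\mathbb{R}$.
   Context: Normality: a real number $x\in[0,1)$ is called normal if its decimal expansion $x=0.d_1d_2\ldots$ satisfies $\lim_{n\to\infty}\frac{1}{n}\sum_{i=1}^n d_i=4.5$. A real number $x\in\mathbb{R}$ is called normal if its fractional part $\{x\}=x-\lfloor x\rfloor$ is normal. A Borel measure on $\mathbb{R}$ is a (countably additive, $[0,\infty]$-valued) measure $\mu$ defined on a $\sigma$-algebra $\mathcal{S}$ of subsets of $\mathbb{R}$ containing all Borel sets ($\mathcal S$ may be larger than the Borel $\sigma$-algebra, and $\mu$ is not assumed to be $\sigma$-finite on $\mathbb{R}$). It is translation invariant if $S+t\in\mathcal{S}$ and $\mu(S+t)=\mu(S)$ for all $S\in\mathcal{S}$, $t\in\mathbb{R}$. A Borel set $B$ is $\sigma$-finite for $\mu$ if it is a countable union of sets in $\mathcal{S}$ of finite $\mu$-measure. A nonempty Borel set $B\subset\mathbb{R}$ is called immeasurable if for every translation invariant Borel measure $\mu$ on $\mathbb{R}$, either $\mu(B)=0$ or $B$ is not $\sigma$-finite for $\mu$. *)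

(* Defs.v *)
From mathcomp Require Import all_boot all_order all_algebra.
From mathcomp Require Import all_classical all_reals all_analysis.

Set Implicit Arguments.
Unset Strict Implicit.
Unset Printing Implicit Defensive.

Import Order.TTheory GRing.Theory Num.Theory.
Import numFieldNormedType.Exports.

Local Open Scope classical_set_scope.
Local Open Scope ring_scope.

Section Normality.
Context {R : realType}.
Implicit Types x : R.

(* For x in [0, 1) and i >= 1, this is d_i in x = 0.d_1 d_2 ..., in the
   expansion without a tail of 9's; see [digit_bounds] and [digit_approx]. *)
Definition digit x (i : nat) : int := (Num.floor (x * 10 ^+ i) %% 10)%Z.

(* The quotient is the junk value 0 at n = 0, which does not affect the
   limit. *)
Definition normal_unit x : Prop :=
  (\sum_(1 <= i < n.+1) (digit x i)%:~R) / n%:R @[n --> \oo] --> (9 / 2 : R).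

Definition fractional_part x : R := x - (Num.floor x)%:~R.

Definition normal x : Prop := normal_unit (fractional_part x).

Lemma digit_bounds x i : (0 <= digit x i < 10)%R.
Proof. by rewrite /digit modz_ge0//= ltz_pmod. Qed.

Lemma floor_div10 x : (Num.floor (x * 10) %/ 10)%Z = Num.floor x.
Proof.
have /andP[lx xu] := floor_itv x.
have l10 : Num.floor x * 10 <= Num.floor (x * 10).
  by rewrite floor_ge_int intrM ler_pM2r.
have u10 : Num.floor (x * 10) < (Num.floor x + 1) * 10.
  by rewrite floor_lt_int intrM ltr_pM2r.
apply/eqP; rewrite eq_le -ltzD1 ltz_divLR// lez_divRL//.
by rewrite u10.
Qed.

Lemma digit_sum x n : 0 <= x < 1 ->
  \sum_(1 <= i < n.+1) ((digit x i)%:~R / 10 ^+ i : R)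
  = (Num.floor (x * 10 ^+ n))%:~R / 10 ^+ n.
Proof.
move=> x01; elim: n => [|n IH].
  rewrite big_geq// expr0 mulr1 divr1.
  have -> : Num.floor x = 0 by apply: floor_def; rewrite add0r.
  by [].
rewrite big_nat_recr//= IH /digit exprSr mulrA.
set y := x * 10 ^+ n; rewrite [in RHS](divz_eq (Num.floor (y * 10)) 10).
rewrite floor_div10 [in RHS]intrD [in RHS]intrM [in RHS]mulrDl; congr (_ + _).
by rewrite -mulf_div divff ?mulr1// pnatr_eq0.
Qed.

Lemma digit_approx x n : 0 <= x < 1 ->
  let s := \sum_(1 <= i < n.+1) ((digit x i)%:~R / 10 ^+ i : R) in
  s <= x < s + (10 ^+ n)^-1.
Proof.
move=> x01 /=; rewrite digit_sum//.
have p : 0 < (10 : R) ^+ n by rewrite exprn_gt0.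
have /andP[l u] := floor_itv (x * 10 ^+ n).
rewrite ler_pdivrMr// l /= -[X in _ + X]mul1r -mulrDl ltr_pdivlMr//.
by rewrite intrD in u.
Qed.

End Normality.

Section Immeasurability.
Context {R : realType}.

Definition translate (A : set R) (t : R) : set R := [set x + t | x in A].

Definition borel_sigma_algebra (S : set (set R)) : Prop :=
  sigma_algebra setT S /\ (measurable : set (set R)) `<=` S.

(* When S is a sigma-algebra, the measurable sets of [g_sigma_algebraType S]
   are exactly the members of S ([measurable_g_measurableTypeE]). *)
Definition translation_invariant (S : set (set R))
    (mu : {measure set (g_sigma_algebraType S) -> \bar R}) : Prop :=
  forall (A : set R) (t : R), S A ->
    S (translate A t) /\ mu (translate A t) = mu A.

Definition immeasurable (B : set R) : Prop :=
  [/\ B !=set0, (measurable : set (set R)) B &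
    forall (S : set (set R))
      (mu : {measure set (g_sigma_algebraType S) -> \bar R}),
      borel_sigma_algebra S -> translation_invariant mu ->
      mu B = 0%E \/ ~ sigma_finite (B : set (g_sigma_algebraType S)) mu].

End Immeasurability.

(* Main.v *)
(* Call a block of consecutive decimal digits biased if its average is far from
   4.5. Cut the positions into blocks whose length is about 1/q of their
   endpoint. A number with infinitely many biased blocks is not normal; and if x
   is not normal then, for q large, infinitely many biased blocks of x have index
   a mod q and infinitely many have index b mod q, for some a <> b, because one
   residue class carries only a fraction O(1/q) of the digits. Let A be the set of
   those x, let B be the set of non-normal numbers, and let mu be a translation
   invariant measure for which B is sigma-finite; mu restricted to B has the same
   null sets as some finite measure rho. Let t have arbitrary digits in the
   blocks of index a mod q and zeros elsewhere. By Chebyshev's inequality, for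
   all but a small proportion of the choices of a block of t, the set of y for
   which that block of y + t or y - t is biased has small rho-measure, so by
   Borel-Cantelli t can be chosen such that A + t and A - t are rho-null, whence
   mu((A + t) /\ B) = mu((A - t) /\ B) = 0. On the other hand t is zero in the
   blocks of index b mod q, so every x in A retains infinitely many biased blocks
   in x + t or in x - t. Hence A is covered by A /\ (B - t) and A /\ (B + t),
   whose measures vanish by translation invariance. *)
Require Import Defs.
From mathcomp Require Import all_boot all_order all_algebra.
From mathcomp Require Import all_classical all_reals all_analysis.
From mathcomp Require Import measurable_realfun zify ring lra.

Set Implicit Arguments.
Unset Strict Implicit.
Unset Printing Implicit Defensive.

Import Order.TTheory GRing.Theory Num.Theory.
Import numFieldNormedType.Exports.

Local Open Scope classical_set_scope.
Local Open Scope ring_scope.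

(** * Second moment of digit sums and the number of biased blocks *)

(* Up to the factor 2, how far the sum of the last l decimal digits of z is
   from its expected value 4.5 l. *)
Definition deviation (l : nat) (z : int) : int :=
  \sum_(0 <= i < l) (((z %/ 10 ^+ i)%Z %% 10)%Z * 2 - 9).

Lemma deviation0 z : deviation 0 z = 0.
Proof. by rewrite /deviation big_geq. Qed.

Lemma deviationS l z :
  deviation l.+1 z = ((z %% 10)%Z * 2 - 9) + deviation l (z %/ 10)%Z.
Proof.
rewrite /deviation big_nat_recl// expr0 divz1; congr (_ + _).
by apply: eq_bigr => i _; rewrite exprS divzMA_ge0.
Qed.

Lemma deviation_periodic l z k : deviation l (z + k * 10 ^+ l) = deviation l z.
Proof.
elim: l z => [|l IH] z; first by rewrite !deviation0.
rewrite !deviationS exprSr mulrA [z + _]addrC modzMDl divzMDl//.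
by rewrite [_ + (z %/ 10)%Z]addrC IH.
Qed.

Lemma deviation_bound l z : `|deviation l z| <= 9 * l%:Z.
Proof.
elim: l z => [|l IH] z; first by rewrite deviation0.
rewrite deviationS; have := IH (z %/ 10)%Z.
have : 0 <= (z %% 10)%Z by rewrite modz_ge0.
have : (z %% 10)%Z < 10 by rewrite ltz_pmod.
lia.
Qed.

(* 33 is the average of (2d - 9)^2 over the digits d = 0, ..., 9. *)
Lemma sum_deviation_sqr l :
  \sum_(0 <= w < 10 ^ l) deviation l w%:Z ^+ 2 = 33 * l%:Z * 10 ^+ l.
Proof.
elim: l => [|l IH]; first by rewrite expn0 big_nat1 deviation0 mulr0 mul0r.
rewrite expnSr big_nat_mul/=.
(* Splitting off the last digit d: since the numbers 2d - 9 sum to 0 and their squares to 330, the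
   cross term vanishes. *)
transitivity (\sum_(0 <= w < 10 ^ l) (10 * deviation l w%:Z ^+ 2 + 330)).
  apply: eq_bigr => w _.
  rewrite -[X in \sum_(X <= _ < _) _]add0n big_addn mulSn addnK.
  transitivity (\sum_(0 <= d < 10) (d%:Z * 2 - 9 + deviation l w%:Z) ^+ 2).
    apply: eq_big_nat => d /andP[_ d10].
    rewrite deviationS PoszD PoszM [d%:Z + _]addrC modzMDl divzMDl// modz_small//.
    by rewrite divz_small// addr0.
  by rewrite unlock/=; ring.
rewrite big_split/= -mulr_sumr IH sumr_const_nat subn0.
rewrite exprS -[330 *+ _]mulr_natr natrX intS; ring.
Qed.

Definition biased (q l : nat) (z : int) : bool := l%:Z <= q%:Z * `|deviation l z|.

Lemma biased_periodic q l z k : biased q l (z + k * 10 ^+ l) = biased q l z.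
Proof. by rewrite /biased deviation_periodic. Qed.

(** Chebyshev's inequality: a biased block contributes at least $(l/q)^2$ to the second moment in
    [sum_deviation_sqr]. *)
Lemma biased_count q l :
  ((\sum_(0 <= w < 10 ^ l) biased q l w%:Z) * l <= 33 * q ^ 2 * 10 ^ l)%N.
Proof.
case: l => [|l]; first by rewrite muln0.
set L := l.+1; set s := (\sum_(_ <= _ < _) _)%N.
suff : s%:Z * L%:Z ^+ 2 <= q%:Z ^+ 2 * (33 * L%:Z * 10 ^+ L).
  rewrite (_ : q%:Z ^+ 2 * _ = (33 * q ^ 2 * 10 ^ L)%N%:Z * L%:Z).
    by rewrite expr2 mulrA ler_pM2r// -PoszM lez_nat.
  by rewrite !PoszM -!natrX -!natz natrX; ring.
rewrite -sum_deviation_sqr mulr_sumr -natz natr_sum mulr_suml.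
apply: ler_sum => w _; rewrite natz.
case: (boolP (biased q L w)) => [|_]; last by rewrite mul0r mulr_ge0// sqr_ge0.
rewrite /biased mul1r -exprMn => h.
by rewrite -[X in _ <= X]real_normK ?num_real// normrM ger0_norm// ler_sqr// nnegrE.
Qed.

(** Moving a window of length [M] by one position drops one value and picks up an equal one. *)
Lemma sum_shift (M : nat) (f : int -> nat) (z : int) :
  (forall y, f (y + M%:Z) = f y) ->
  (\sum_(0 <= w < M) f (z + w%:Z)%R = \sum_(0 <= w < M) f w%:Z)%N.
Proof.
move=> fM; case: M fM => [|M] fM; first by rewrite !big_geq.
pose g y := (\sum_(0 <= w < M.+1) f (y + w%:Z)%R)%N.
have gS y : g (y + 1) = g y.
  rewrite /g big_nat_recr//= [RHS]big_nat_recl//= addr0 addnC; congr addn.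
    by rewrite -(fM y); congr f; lia.
  by apply: eq_bigr => i _; congr f; lia.
have -> : (\sum_(0 <= w < M.+1) f w%:Z = g 0)%N.
  by apply: eq_bigr => i _; rewrite add0r.
elim/int_rect: z => [//|n IH|n IH].
  by rewrite -IH -[RHS]gS; congr g; lia.
by rewrite -IH -[LHS]gS; congr g; lia.
Qed.

Lemma sum_shift_sub (M : nat) (f : int -> nat) (z : int) :
  (forall y, f (y + M%:Z) = f y) ->
  (\sum_(0 <= w < M) f (z - w%:Z)%R = \sum_(0 <= w < M) f w%:Z)%N.
Proof.
move=> fM; rewrite big_nat_rev/= -(sum_shift (z - M%:Z + 1) fM).
apply: eq_big_nat => w /andP[_ wM]; congr f; lia.
Qed.

(* The summands 1 account for a carry or a borrow from the digits to the right
   of the block. *)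
Definition reach_biased q l (z : int) (w : nat) : bool :=
  [|| biased q l (z + w%:Z), biased q l (z + w%:Z + 1),
      biased q l (z - w%:Z) | biased q l (z - w%:Z - 1)].

(** Each of the four conditions tests [biased] along a shifted or reflected full period, so
    [biased_count] applies to it; $132 = 4 \cdot 33$. *)
Lemma reach_biased_count q l z :
  ((\sum_(0 <= w < 10 ^ l) reach_biased q l z w) * l <= 132 * q ^ 2 * 10 ^ l)%N.
Proof.
have per y : biased q l (y + (10 ^ l)%N%:Z) = biased q l y.
  by rewrite -(biased_periodic q l y 1) mul1r -natz natrX.
have perN y : (biased q l (y + (10 ^ l)%N%:Z) : nat) = biased q l y by rewrite per.
have e1 := sum_shift z perN.
have e2 := sum_shift (z + 1) perN.
have e3 := sum_shift_sub z perN.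
have e4 := sum_shift_sub (z - 1) perN.
have c := biased_count q l.
have : (\sum_(0 <= w < 10 ^ l) reach_biased q l z w <=
   4 * \sum_(0 <= w < 10 ^ l) biased q l w%:Z)%N.
  rewrite !mulSn mul0n addn0 -[X in (_ <= X + _)%N]e1 -[X in (_ <= _ + (X + _))%N]e2.
  rewrite -[X in (_ <= _ + (_ + (X + _)))%N]e3 -[X in (_ <= _ + (_ + (_ + X)))%N]e4.
  rewrite -!big_split/=; apply: leq_sum => w _; rewrite /reach_biased.
  rewrite (addrAC z 1) (addrAC z (-1)).
  by do 4 case: (biased _ _ _).
nia.
Qed.

(** * Cutting the digit positions into blocks *)

(* Block j consists of the positions i with
   [block_start q j < i <= block_start q j.+1]. Each block is at least
   1/(2q) of its endpoint, so a single biased block is visible in the average,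
   and at most 1/q of it; moreover [block_start q (j + q)] is twice
   [block_start q j]. *)
Definition block_start (q j : nat) : nat := (2 ^ (j %/ q) * (q + j %% q))%N.
Definition block_len (q j : nat) : nat := (2 ^ (j %/ q))%N.

Lemma block_len_gt0 q j : (0 < block_len q j)%N.
Proof. by rewrite expn_gt0. Qed.

Lemma block_startS q j : (0 < q)%N ->
  block_start q j.+1 = (block_start q j + block_len q j)%N.
Proof.
move=> q0; rewrite /block_start /block_len; have r := ltn_pmod j q0.
have jE := divn_eq j q.
have [rq|rq] := ltnP (j %% q).+1 q.
  have -> : (j.+1 %/ q = j %/ q)%N by rewrite {1}jE -addnS divnMDl// (divn_small rq) addn0.
  have -> : (j.+1 %% q = (j %% q).+1)%N by rewrite {1}jE -addnS modnMDl modn_small.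
  by rewrite addnS mulnS addnC.
have e : j.+1 = ((j %/ q).+1 * q)%N by lia.
by rewrite e mulnK// modnMl expnS; nia.
Qed.

Lemma leq_block_start q i j : (0 < q)%N -> (i <= j)%N ->
  (block_start q i <= block_start q j)%N.
Proof.
move=> q0 ij; rewrite -(subnK ij); elim: (j - i)%N => // k IH.
by rewrite addSn block_startS// (leq_trans IH)// leq_addr.
Qed.

Lemma block_start_ge q j : (0 < q)%N -> (j <= block_start q j)%N.
Proof.
move=> q0; elim: j => // j IH; rewrite block_startS//.
by have := block_len_gt0 q j; lia.
Qed.

Lemma block_start_le_len q j : (0 < q)%N ->
  (block_start q j.+1 <= 2 * q * block_len q j)%N.
Proof.
move=> q0; rewrite block_startS// /block_start /block_len.
by have := ltn_pmod j q0; nia.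
Qed.

Lemma len_le_block_start q j : (q * block_len q j <= block_start q j)%N.
Proof. by rewrite /block_start /block_len; nia. Qed.

Lemma block_bracket q n : (0 < q)%N -> (q <= n)%N ->
  exists j, (block_start q j <= n < block_start q j.+1)%N.
Proof.
move=> q0; elim: n => [|n IH] qn; first by lia.
have [qn1|nq] := leqP q n.
  have [j /andP[jn nj]] := IH qn1.
  have [h|h] := ltnP n.+1 (block_start q j.+1); first by exists j; rewrite h; lia.
  by exists j.+1; rewrite h /= (block_startS j.+1 q0); have := block_len_gt0 q j.+1; lia.
exists 0%N; rewrite block_startS// /block_start /block_len div0n mod0n; lia.
Qed.

(** The exponent is the number of indices below [J] that are a mod q; their block lengths 1, 2, 4,
    ... form a geometric sum. *)
Lemma sum_block_len_residue q a J : (a < q)%N ->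
  ((\sum_(0 <= i < J | i %% q == a) block_len q i)%N < 2 ^ ((J + (q - 1 - a)) %/ q))%N.
Proof.
move=> aq; elim: J => [|J IH]; first by rewrite big_geq// expn_gt0.
have q0 : (0 < q)%N by lia.
rewrite big_mkcond big_nat_recr//= -big_mkcond/=.
case: eqP => [e|_]; last first.
  by rewrite addn0 (leq_trans IH)// leq_pexp2l// leq_div2r// leq_add2r.
have := divn_eq J q; rewrite e => eJ; rewrite /block_len in IH *; move: IH eJ.
move: (J %/ q)%N => k IH eJ; move: IH.
have -> : (J + (q - 1 - a) = k * q + (q - 1))%N by lia.
have -> : (J.+1 + (q - 1 - a) = k.+1 * q)%N by rewrite mulSn; lia.
rewrite mulnK// divnMDl// divn_small ?addn0; last by lia.
by rewrite expnS; lia.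
Qed.

(** * Normality in terms of biased blocks *)

Section Digits.
Context {R : realType}.
Implicit Types x : R.

Definition excess x n : int := \sum_(1 <= i < n.+1) (digit x i * 2 - 9).

Lemma digit_fractional_part x i : (0 < i)%N -> digit (fractional_part x) i = digit x i.
Proof.
case: i => // i _; rewrite /digit /fractional_part mulrBl -[10 ^+ i.+1]natrX.
rewrite [_%:R]pmulrn -intrM -intrN floorDrz ?rpred_int// intrKfloor.
rewrite expnS natz PoszM mulrCA -mulrN addrC.
by rewrite mulrC modzMDl.
Qed.

Lemma floor_div_exp x i k :
  Num.floor (x * 10 ^+ i) = (Num.floor (x * 10 ^+ (i + k)) %/ 10 ^+ k)%Z.
Proof.
elim: k => [|k IH]; first by rewrite addn0 expr0 divz1.
rewrite exprS divzMA_ge0// addnS exprSr mulrA floor_div10.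
exact: IH.
Qed.

(** The digits at positions p + 1, ..., p + l are, in reverse order, the last l digits of the
    integer part of $10^{p+l} x$. *)
Lemma excess_block x p l :
  excess x (p + l) - excess x p = deviation l (Num.floor (x * 10 ^+ (p + l))).
Proof.
rewrite /excess (@big_cat_nat _ _ _ p.+1)//=; last by rewrite ltnS leq_addr.
rewrite [X in X - _]addrC addrK /deviation big_nat_rev/=.
rewrite -{1}[p.+1]add0n big_addn -addSn addKn.
apply: eq_big_nat => i /andP[_ il]; congr (_ * _ - _).
by rewrite /digit (floor_div_exp x _ i);
  congr (((Num.floor (x * 10 ^+ _) %/ _)%Z %% _)%Z); lia.
Qed.

Lemma excess_dist x p l : `|excess x (p + l) - excess x p| <= 9 * l%:Z.
Proof. by rewrite excess_block deviation_bound. Qed.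

Lemma normal_excessP x : normal x <->
  forall e : R, 0 < e -> exists N, forall n, (N <= n)%N ->
    `|(excess x n)%:~R| <= e * n%:R.
Proof.
have avg n : (0 < n)%N ->
  (\sum_(1 <= i < n.+1) (digit (fractional_part x) i)%:~R) / n%:R - 9 / 2
  = (excess x n)%:~R / n%:R / 2 :> R.
  move=> n0; have nR : (n%:R : R) != 0 by rewrite pnatr_eq0 -lt0n.
  rewrite /excess big_split/= -mulr_suml sumr_const_nat subSS subn0.
  rewrite -[-9 *+ n]mulr_natr natz intrD !intrM rmorph_sum/= -!pmulrn.
  rewrite (eq_big_nat _ _ (F2 := fun i => (digit x i)%:~R)); last first.
    by move=> i /andP[i0 _]; rewrite digit_fractional_part.
  by field.
split=> [/cvgrPdist_le h e e0|h].
  have /h[N _ hN] : 0 < e / 2 by rewrite divr_gt0.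
  exists N.+1 => n Nn; have n0 : (0 < n)%N by lia.
  have nR : 0 < (n%:R : R) by rewrite ltr0n.
  have := hN n (ltnW Nn); rewrite /= distrC avg// normrM [`|_^-1|]gtr0_norm ?invr_gt0//.
  by rewrite ler_pM2r ?invr_gt0// normrM [`|_^-1|]gtr0_norm ?invr_gt0// ler_pdivrMr.
apply/cvgrPdist_le => e e0; have [N hN] := h e e0.
exists N.+1 => // n /= Nn; have n0 : (0 < n)%N by lia.
have nR : 0 < (n%:R : R) by rewrite ltr0n.
rewrite distrC avg// normrM [`|2^-1|]gtr0_norm ?invr_gt0// ler_pdivrMr//.
rewrite normrM [`|n%:R^-1|]gtr0_norm ?invr_gt0// ler_pdivrMr//.
apply: le_trans (hN n (ltnW Nn)) _; rewrite ler_wpM2r// ?ltW//; lra.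
Qed.

Definition biased_block q x j :=
  biased q (block_len q j) (Num.floor (x * 10 ^+ block_start q j.+1)).

Lemma normal_not_biased q x : (0 < q)%N -> normal x ->
  exists N, forall j, (N <= j)%N -> ~~ biased_block q x j.
Proof.
(* A biased block changes the excess by at least 1/q of its length, hence by $1/(2q^2)$ of its
   endpoint; tolerance $1/(8q^2)$ at both ends allows only half of that. *)
move=> q0 /normal_excessP/(_ (8 * q%:R ^+ 2)^-1)[|N hN].
  by rewrite invr_gt0 mulr_gt0// exprn_gt0// ltr0n.
have {}hN n : (N <= n)%N -> 8 * q%:Z ^+ 2 * `|excess x n| <= n%:Z.
  move=> /hN; rewrite mulrC ler_pdivlMr; last by rewrite mulr_gt0// exprn_gt0// ltr0n.
  by rewrite -(ler_int R) !intrM intr_norm mulrC.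
exists N => j Nj; have pj := block_start_ge j q0.
have := hN _ (leq_trans Nj pj).
have := hN _ (leq_trans (leq_trans Nj pj) (leq_block_start q0 (leqnSn j))).
rewrite /biased_block /biased block_startS// -excess_block -block_startS//.
have l0 := block_len_gt0 q j; have := block_start_le_len j q0.
have := leq_block_start q0 (leqnSn j).
move: (excess x _) (excess x _) => u v h1 h2 h3 h4; rewrite -ltNge.
have h : q%:Z * (8 * q%:Z * `|v - u|) <= q%:Z * (4 * (block_len q j)%:Z).
  apply: (@le_trans _ _ (8 * q%:Z ^+ 2 * `|u| + 8 * q%:Z ^+ 2 * `|v|)).
    rewrite (_ : q%:Z * _ = 8 * q%:Z ^+ 2 * `|v - u|); last by ring.
    by rewrite -mulrDr ler_wpM2l ?mulr_ge0 ?sqr_ge0//; lia.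
  lia.
by move: h; rewrite ler_pM2l; lia.
Qed.

Definition often_biased q a x :=
  forall N, exists j, [/\ (N <= j)%N, (j %% q = a)%N & biased_block q x j].

Lemma often_biased_not_normal q a x : (0 < q)%N -> often_biased q a x -> ~ normal x.
Proof.
move=> q0 h /(normal_not_biased q0)[N hN].
by have [j [/hN/negP]] := h N.
Qed.

(* The blocks in a single residue class mod q make up only a fraction O(1/q) of
   all positions, so they alone cannot spoil normality for large q. *)
Lemma excess_growth q a N x J : (a < q)%N ->
  (forall j, (N <= j)%N -> (j %% q != a)%N -> ~~ biased_block q x j) ->
  (N <= J)%N ->
  q%:Z * `|excess x (block_start q J)| <=
    q%:Z * `|excess x (block_start q N)| + 19 * (block_start q J)%:Z.
Proof.
move=> aq h NJ; have q0 : (0 < q)%N by lia.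
pose G J := (\sum_(0 <= i < J | i %% q == a) block_len q i)%N.
(* Unbiased blocks raise q times the excess by at most their length, blocks of class a by at most 9q
   times their length. As [q * G J] is at most twice [block_start q J], this gives 19 = 1 + 18. *)
suff : q%:Z * `|excess x (block_start q J)| <=
    q%:Z * `|excess x (block_start q N)| + (block_start q J)%:Z + 9 * q%:Z * (G J)%:Z.
  have : (q * G J <= 2 * block_start q J)%N.
    have := sum_block_len_residue J aq; rewrite -/(G J) => gJ.
    have h2 : ((J + (q - 1 - a)) %/ q <= (J %/ q).+1)%N.
      by rewrite -ltnS ltn_divLR//; have := ltn_ceil J q0; lia.
    have := leq_pexp2l (isT : 0 < 2)%N h2; rewrite expnS -/(block_len q J).
    have := len_le_block_start q J; nia.
  lia.
rewrite -(subnK NJ); elim: (J - N)%N => [|k IH].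
  by rewrite add0n; lia.
rewrite addSn; set j := (k + N)%N in IH *.
have Nj : (N <= j)%N by rewrite leq_addl.
have GS : G j.+1 = (G j + (if j %% q == a then block_len q j else 0))%N.
  by rewrite /G big_mkcond big_nat_recr//= -big_mkcond.
have d1 := excess_dist x (block_start q j) (block_len q j).
have d2 := excess_block x (block_start q j) (block_len q j).
have := h j Nj; rewrite /biased_block /biased block_startS// -d2 GS.
move: d1 IH; move: (excess x _) (excess x (block_start q j)) => u v d1 IH.
case: eqP => [e _|e /(_ isT)]; first by nia.
by rewrite -ltNge; nia.
Qed.

Lemma not_normal_often_biased x : ~ normal x ->
  exists q a b, [/\ (2 < q)%N, (a < q)%N, (b < q)%N, a != b &
    often_biased q a x /\ often_biased q b x].
Proof.
apply: contra_notP => H; apply/normal_excessP => e e0.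
(* 30 exceeds 19 + 9 + 1: the growth over full blocks, the incomplete last block, and the initial
   excess, which is absorbed by n. Adding 3 ensures q > 2. *)
pose q := (Num.truncn (30 / e) + 3)%N.
have q2 : (2 < q)%N by rewrite /q addn3.
have qe : 30 <= e * q%:R.
  rewrite mulrC -ler_pdivrMr// /q natrD; apply: ltW.
  by apply: (lt_le_trans (truncnS_gt _)); rewrite -natrD ler_nat -addn1 leq_add2l.
(* By [H] at most one residue class is often biased; if there is none, 0 serves as [a]. *)
have [a [aq ha]] : exists a, (a < q)%N /\
    forall b, (b < q)%N -> b != a -> ~ often_biased q b x.
  have [[a [aq ha]]|no] := pselect (exists a, (a < q)%N /\ often_biased q a x).
    by exists a; split=> // b bq ba hb; apply: H; exists q, b, a.
  exists 0%N; split; first lia.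
  by move=> b bq _ hb; apply: no; exists b.
have [N hN] : exists N, forall j, (N <= j)%N -> (j %% q != a)%N -> ~~ biased_block q x j.
  have : forall r, (r <= q)%N -> exists N, forall j, (N <= j)%N -> (j %% q < r)%N ->
      (j %% q != a)%N -> ~~ biased_block q x j.
    elim=> [|r IH] rq; first by exists 0%N.
    have [N hN] := IH (ltnW rq).
    have [e_ra|ra] := eqVneq r a.
      exists N => j Nj jr ja; apply: (hN j Nj) => //.
      by rewrite ltn_neqAle -ltnS jr andbT e_ra.
    have /existsNP[N' hN'] := ha r rq ra.
    exists (maxn N N') => j; rewrite geq_max ltnS => /andP[Nj N'j].
    rewrite leq_eqVlt => /predU1P[jr _|jr ja]; last exact: hN.
    by apply/negP => jb; apply: hN'; exists j.
  move=> /(_ q (leqnn q))[N hN]; exists N => j Nj; apply: hN => //.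
  by rewrite ltn_pmod//; lia.
pose C := absz (q%:Z * `|excess x (block_start q N)|).
exists (maxn (block_start q N) C) => n; rewrite geq_max => /andP[Nn Cn].
have q0 : (0 < q)%N by lia.
have [J /andP[Jn nJ]] : exists j, (block_start q j <= n < block_start q j.+1)%N.
  apply: block_bracket => //; apply: leq_trans Nn.
  have := leq_block_start q0 (leq0n N).
  by rewrite [X in (X <= _)%N]/block_start div0n mod0n; lia.
have NJ : (N <= J)%N.
  by rewrite leqNgt; apply/negP => /(leq_block_start q0); lia.
have g := excess_growth aq hN NJ.
have d : `|excess x n - excess x (block_start q J)| <= 9 * (block_len q J)%:Z.
  have := excess_dist x (block_start q J) (n - block_start q J).
  rewrite subnKC// block_startS// in nJ *.
  lia.
have lp := len_le_block_start q J.
have : q%:Z * `|excess x n| <= 30 * n%:Z by nia.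
have qR : 0 < (q%:R : R) by rewrite ltr0n.
move=> h; rewrite -(ler_pM2l qR).
have : (q%:Z * `|excess x n|)%:~R <= (30 * n%:Z)%:~R :> R by rewrite ler_int.
rewrite !intrM intr_norm => /le_trans; apply.
by rewrite mulrA [q%:R * e]mulrC ler_wpM2r.
Qed.

End Digits.

(** * Carries and borrows when t is added or subtracted *)

Section Carries.
Context {R : realType}.
Implicit Types (x y t : R) (T : int).

Lemma floorD_carry y T t : 0 <= t <= 1 ->
  Num.floor (y + (T%:~R + t)) = Num.floor y + T \/
  Num.floor (y + (T%:~R + t)) = Num.floor y + T + 1.
Proof.
move=> /andP[t0 t1]; have /andP[h1 h2] := floor_itv y; rewrite intrD in h2.
have [h|h] := ltP (y + t) ((Num.floor y)%:~R + 1).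
  by left; apply: floor_def; rewrite !intrD; lra.
by right; apply: floor_def; rewrite !intrD; lra.
Qed.

Lemma floorB_borrow y T t : 0 <= t <= 1 ->
  Num.floor (y - (T%:~R + t)) = Num.floor y - T \/
  Num.floor (y - (T%:~R + t)) = Num.floor y - T - 1.
Proof.
move=> /andP[t0 t1]; have /andP[h1 h2] := floor_itv y; rewrite intrD in h2.
have [h|h] := ltP (y - t) (Num.floor y)%:~R.
  by right; apply: floor_def; rewrite !(intrD, intrN); lra.
by left; apply: floor_def; rewrite !(intrD, intrN); lra.
Qed.

(** A carry needs the fractional part of y to be at least 1 - t, a borrow needs it below t; for t at
    most 1/2 these exclude each other. *)
Lemma floor_no_carry_or_no_borrow y T t : 0 <= t <= 2^-1 ->
  Num.floor (y + (T%:~R + t)) = Num.floor y + T \/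
  Num.floor (y - (T%:~R + t)) = Num.floor y - T.
Proof.
move=> /andP[t0 t1]; have /andP[h1 h2] := floor_itv y; rewrite intrD in h2.
have [h|h] := ltP (y + t) ((Num.floor y)%:~R + 1).
  by left; apply: floor_def; rewrite !intrD; lra.
by right; apply: floor_def; rewrite !(intrD, intrN); lra.
Qed.

(** Here [tau] is the part of t to the right of block j, in units of its last digit; it equals 1
    when all later digits are 9. *)
Lemma digit_block_real q (w : nat -> nat) : (0 < q)%N ->
  (forall j, (w j < 10 ^ block_len q j)%N) ->
  exists t, forall j, exists (k : int) tau,
    [/\ t * 10 ^+ block_start q j.+1 = (k * 10 ^+ block_len q j + (w j)%:Z)%:~R + tau,
        0 <= tau <= 1 & w j.+1 = 0%N -> tau <= 2^-1].
Proof.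
move=> q0 wlt.
pose Z := fix Z n : int :=
  if n is m.+1 then Z m * 10 ^+ block_len q m + (w m)%:Z else 0.
pose e n : R := 10 ^+ block_start q n.
have e0 n : 0 < e n by rewrite exprn_gt0.
have eS n : e n.+1 = e n * 10 ^+ block_len q n by rewrite /e block_startS// exprD.
pose u n : R := (Z n)%:~R / e n.
have ZS n : (Z n.+1)%:~R = (Z n)%:~R * 10 ^+ block_len q n + (w n)%:R :> R.
  by rewrite /= intrD intrM rmorphXn/= -pmulrn.
have uS n : u n.+1 = u n + (w n)%:R / e n.+1.
  rewrite /u ZS mulrDl eS; congr (_ + _).
  by rewrite -mulf_div divff ?mulr1// expf_neq0.
have u_le n : u n <= u n.+1 by rewrite uS lerDl divr_ge0// ltW.
have ue_ge n : u n.+1 + (e n.+1)^-1 <= u n + (e n)^-1.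
  rewrite uS -addrA lerD2l -[X in _ + X]mul1r -mulrDl ler_pdivrMr// eS.
  rewrite mulrA mulVf ?gt_eqF// mul1r natr1 -natrX ler_nat; exact: wlt.
have u_mono i k : u i <= u (i + k)%N.
  by elim: k => [|k IH]; rewrite ?addn0// addnS (le_trans IH).
have ue_mono i k : u (i + k)%N + (e (i + k)%N)^-1 <= u i + (e i)^-1.
  by elim: k => [|k IH]; rewrite ?addn0// addnS; apply: le_trans IH.
have u_ub n i : u i <= u n + (e n)^-1.
  apply: le_trans (u_mono i n) _; apply: le_trans (ue_mono n i).
  by rewrite addnC lerDl invr_ge0 ltW.
(* The intervals from [u n] to [u n + (e n)^-1] are nested, so the supremum of their left ends lies
   in all of them. *)
pose t := sup (range u).
have t_ge n : u n <= t.
  apply: ub_le_sup; last by exists n.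
  by exists (u 0%N + (e 0%N)^-1) => _ [i _ <-]; exact: u_ub.
have t_le n : t <= u n + (e n)^-1.
  by apply: ge_sup; [exists (u 0%N), 0%N | move=> _ [i _ <-]; exact: u_ub].
exists t => j; exists (Z j), (t * e j.+1 - (Z j.+1)%:~R); split.
- by rewrite -/(Z j.+1) addrC subrK.
- have := t_ge j.+1; have := t_le j.+1.
  rewrite -(ler_pM2r (e0 j.+1)) -[u _ <= t](ler_pM2r (e0 j.+1)).
  by rewrite mulrDl mulVf ?gt_eqF// /u divfK ?gt_eqF//; lra.
- move=> w0; have := t_le j.+2; rewrite uS w0 mul0r addr0 => h.
  have : t * e j.+1 <= (u j.+1 + (e j.+2)^-1) * e j.+1 by rewrite ler_pM2r.
  rewrite mulrDl /u divfK ?gt_eqF// (eS j.+1) invfM mulrAC mulVf ?gt_eqF// mul1r.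
  have : ((10 : R) ^+ block_len q j.+1)^-1 <= 2^-1.
    rewrite lef_pV2 ?posrE ?exprn_gt0// -natrX ler_nat.
    by have := leq_pexp2l (isT : 0 < 10)%N (block_len_gt0 q j.+1); lia.
  lra.
Qed.

(* If two consecutive digit blocks of t vanish, the part of t to the right of
   the first one is at most half a unit, so that block of x either survives in
   x + t (no carry) or in x - t (no borrow). *)
Lemma shift_exists q (w : nat -> nat) : (0 < q)%N ->
  (forall j, (w j < 10 ^ block_len q j)%N) ->
  exists t,
    (forall j y, biased_block q (y + t) j \/ biased_block q (y - t) j ->
       reach_biased q (block_len q j) (Num.floor (y * 10 ^+ block_start q j.+1)) (w j)) /\
    (forall j x, w j = 0%N -> w j.+1 = 0%N -> biased_block q x j ->
       biased_block q (x + t) j \/ biased_block q (x - t) j).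
Proof.
move=> q0 /(digit_block_real q0)[t ht]; exists t; split=> j y.
  have [k [tau [e tau01 _]]] := ht j.
  rewrite /biased_block mulrDl mulrBl e; move: (y * _) => z.
  have per i : biased q (block_len q j)
               (Num.floor z + (k * 10 ^+ block_len q j + (w j)%:Z) + i)
             = biased q (block_len q j) (Num.floor z + (w j)%:Z + i).
    by rewrite -[RHS](biased_periodic _ _ _ k); congr biased; ring.
  have perN i : biased q (block_len q j)
               (Num.floor z - (k * 10 ^+ block_len q j + (w j)%:Z) + i)
             = biased q (block_len q j) (Num.floor z - (w j)%:Z + i).
    by rewrite -[RHS](biased_periodic _ _ _ (- k)); congr biased; ring.
  have := per 0; have := perN 0; rewrite !addr0 => pN p; rewrite /reach_biased.
  case=> h; apply/or4P.
    case: (floorD_carry z (k * 10 ^+ block_len q j + (w j)%:Z) tau01) h => ->.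
      by rewrite p => h; constructor 1.
    by rewrite per => h; constructor 2.
  case: (floorB_borrow z (k * 10 ^+ block_len q j + (w j)%:Z) tau01) h => ->.
    by rewrite pN => h; constructor 3.
  by rewrite perN => h; constructor 4.
move=> wj wj1; have [k [tau [e /andP[tau0 _] /(_ wj1) tau2]]] := ht j.
rewrite /biased_block mulrDl mulrBl e wj addr0; move: (y * _) => z h.
have tau02 : 0 <= tau <= 2^-1 by rewrite tau0.
have [->|->] := floor_no_carry_or_no_borrow z (k * 10 ^+ block_len q j) tau02.
  by left; rewrite biased_periodic.
by right; rewrite -mulNr biased_periodic.
Qed.

End Carries.

(** * Averaging, finite substitutes for sigma-finite measures, and Borel-Cantelli *)

Section Measure.
Local Open Scope ereal_scope.

(** Integrating the pointwise count bounds the sum of all [mu (E w)]; some w does not exceed the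
    average. *)
Lemma exists_small_measure d (T : measurableType d) (R : realType)
    (mu : {measure set T -> \bar R}) (E : nat -> set T) (M l K : nat) :
  (0 < M)%N -> (forall w, measurable (E w)) ->
  (forall x, (\sum_(0 <= w < M) (x \in E w)) * l <= K * M)%N ->
  mu setT < +oo ->
  exists2 w, (w < M)%N & l%:R%:E * mu (E w) <= K%:R%:E * mu setT.
Proof.
move=> M0 mE hE muT; apply: contrapT => no.
have muE w : mu (E w) \is a fin_num.
  by rewrite ge0_fin_numE// (le_lt_trans _ muT)// le_measure ?inE.
have muTf : mu setT \is a fin_num by rewrite ge0_fin_numE.
have sumE : \sum_(0 <= w < M) mu (E w) = \int[mu]_x (\sum_(0 <= w < M) (\1_(E w) x)%:E).
  rewrite ge0_integral_sum//.
  - by apply: eq_bigr => w _; rewrite integral_indic// setIT.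
  - by move=> w; apply/measurable_EFinP; exact: measurable_indic.
have msum : measurable_fun setT (fun x => \sum_(0 <= w < M) (\1_(E w) x)%:E : \bar R).
  by apply: emeasurable_sum => w; apply/measurable_EFinP; exact: measurable_indic.
have up : l%:R%:E * \sum_(0 <= w < M) mu (E w) <= (K * M)%:R%:E * mu setT.
  rewrite sumE -ge0_integralZl//; last first.
    by move=> x _; apply: sume_ge0 => w _; rewrite lee_fin indicE.
  rewrite -integral_cst//; apply: ge0_le_integral => //.
  - by move=> x _; rewrite mule_ge0 ?lee_fin//; apply: sume_ge0 => w _; rewrite lee_fin indicE.
  - exact: measurable_funeM.
  - move=> x _ /=; rewrite sumEFin -EFinM lee_fin.
    have := hE x; rewrite -(ler_nat R) natrM natr_sum mulrC.
    by under eq_bigr do rewrite -indicE.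
have lo : (K%:R * fine (mu setT) *+ M < l%:R * \sum_(0 <= w < M) fine (mu (E w)))%R.
  rewrite mulr_sumr -[M in X in (X < _)%R]subn0 -sumr_const_nat.
  rewrite !big_nat; apply: ltr_sum => [|w wM].
    by apply/hasP; exists 0%N; rewrite ?mem_index_iota.
  rewrite ltNge; apply/negP => h; apply: no; exists w; first by case/andP: wM.
  by rewrite -(fineK muTf) -(fineK (muE w)) -!EFinM lee_fin.
move: up; rewrite -(fineK muTf) (eq_bigr (fun w => (fine (mu (E w)))%:E)); last first.
  by move=> w _; rewrite fineK.
rewrite sumEFin -!EFinM lee_fin leNgt => /negP; apply.
by rewrite natrM mulrAC -mulr_natr in lo *.
Qed.

Lemma finite_measure_of_sigma_finite d (T : measurableType d) (R : realType)
    (mu : {measure set T -> \bar R}) (B : set T) : sigma_finite B mu ->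
  exists rho : {measure set T -> \bar R}, rho setT < +oo /\
    forall E, measurable E -> rho E = 0 -> mu (E `&` B) = 0.
Proof.
move=> [F -> hF].
have mF i : measurable (F i) by case: (hF i).
(* These weights give the sum of the restrictions of [mu] to the [F i] total mass at most 1, and
   being positive they preserve null sets; the added 1 avoids division by zero. *)
pose c i : R := (1 / (2 ^ i.+1)%:R / (1 + fine (mu (F i))))%R.
have f0 i : (0 < 1 + fine (mu (F i)))%R by rewrite ltr_pwDl// fine_ge0.
have c0 i : (0 < c i)%R by rewrite !divr_gt0// ltr0n expn_gt0.
pose m i : {measure set T -> \bar R} :=
  mscale (NngNum (ltW (c0 i))) (mrestr mu (mF i)).
have mE i X : m i X = (c i)%:E * mu (X `&` F i) by [].
exists (mseries m 0); split.
  apply: (@le_lt_trans _ _ 1%:E); last exact: ltry.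
  apply: le_trans (epsilon_trick0 xpredT ler01); apply: lee_nneseries => [//|i _].
  rewrite mE setTI -[mu _]fineK; last by rewrite ge0_fin_numE//; case: (hF i).
  rewrite -EFinM lee_fin /c mulrAC ler_pdivrMr// ler_wpM2l ?divr_ge0//.
  by rewrite lerDr.
move=> E mE' /= h.
have z i : mu (E `&` F i) = 0.
  have : m i E = 0.
    apply/eqP; rewrite -measure_le0 -h.
    apply: le_trans (@nneseries_lim_ge _ _ xpredT 0 i.+1 _) => //.
    by rewrite big_nat_recr//= leeDr// sume_ge0.
  by rewrite mE => /eqP; rewrite mule_eq0 eqe gt_eqF//= => /eqP.
rewrite setI_bigcupr; apply: measure_negligible.
  by apply: bigcup_measurable => i _; exact: measurableI.
by apply: negligible_bigcup => i; apply/negligibleP; [exact: measurableI | exact: z].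
Qed.

Lemma measurable_floor_preimage (R : realType) (P : set int) (c : R) : (0 < c)%R ->
  measurable [set x : R | P (Num.floor (x * c))].
Proof.
move=> c0; have -> : [set x : R | P (Num.floor (x * c))] =
    \bigcup_(k in P) `[(k%:~R / c)%R, ((k + 1)%:~R / c)%R[%classic.
  apply/seteqP; split=> x /=.
    move=> Px; exists (Num.floor (x * c)) => //=.
    by rewrite in_itv/= ler_pdivrMr// ltr_pdivlMr// floor_itv.
  move=> [k Pk] /=; rewrite in_itv/= ler_pdivrMr// ltr_pdivlMr// => kx.
  by rewrite (floor_def kx).
by rewrite bigcup_mkcond; apply: countable_bigcupT_measurable => // k; case: ifP.
Qed.

(* Averaging over the 10^l candidates for each digit block of t separately
   replaces a product measure on the t's and Fubini's theorem. *)
Lemma null_translation_digits (R : realType) d (T : measurableType d)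
    (v : T -> R) (rho : {measure set T -> \bar R}) (q a : nat) :
  measurable_fun setT v -> rho setT < +oo -> (a < q)%N ->
  exists w : nat -> nat,
    [/\ forall j, (w j < 10 ^ block_len q j)%N,
        forall j, (j %% q)%N != a -> w j = 0%N &
        rho (lim_sup_set (fun k => [set x : T | let j := (k * q + a)%N in
          reach_biased q (block_len q j)
            (Num.floor (v x * 10 ^+ block_start q j.+1)%R) (w j)])) = 0].
Proof.
move=> mv rhoT aq; have q0 : (0 < q)%N by apply: leq_ltn_trans aq.
pose E j w := [set x : T |
  reach_biased q (block_len q j) (Num.floor (v x * 10 ^+ block_start q j.+1)%R) w].
have mE j w : measurable (E j w).
  rewrite -[E j w]setTI; apply: (mv measurableT
    [set y : R | [set z | reach_biased q (block_len q j) z w]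
      (Num.floor (y * 10 ^+ block_start q j.+1)%R)]).
  by apply: measurable_floor_preimage; rewrite exprn_gt0.
have H j : exists w, (w < 10 ^ block_len q j)%N /\
    (block_len q j)%:R%:E * rho (E j w) <= (132 * q ^ 2)%N%:R%:E * rho setT.
  have [|//|x|//|w wM hw] :=
      @exists_small_measure _ _ _ rho (E j) (10 ^ block_len q j) (block_len q j)
        (132 * q ^ 2).
  - by rewrite expn_gt0.
  - have := reach_biased_count q (block_len q j)
      (Num.floor (v x * 10 ^+ block_start q j.+1)%R).
    apply: leq_trans; rewrite leq_mul2r; apply/orP; right.
    by apply: leq_sum => i _; rewrite /E mem_setE.
  - by exists w.
have [W hW] := choice H.
exists (fun j => if (j %% q)%N == a then W j else 0%N); split.
- by move=> j; case: ifP => _; [case: (hW j) | rewrite expn_gt0].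
- by move=> j /negbTE ->.
have rhof : rho setT \is a fin_num by rewrite ge0_fin_numE.
pose F k := E (k * q + a)%N (W (k * q + a)%N).
rewrite (_ : (fun k => _) = F); last first.
  by apply/funext => k /=; rewrite /F /E modnMDl modn_small// eqxx.
pose C : R := ((132 * q ^ 2)%N%:R * fine (rho setT))%R.
(* Borel-Cantelli: block kq + a has length $2^k$, so [rho (F k)] is at most $C/2^k$, which is
   summable. *)
apply: lim_sup_set_cvg0; first by move=> k; exact: mE.
apply: (@le_lt_trans _ _ (2 * C)%:E); last exact: ltry.
have C0 : (0 <= 2 * C)%R by rewrite !mulr_ge0// fine_ge0.
apply: le_trans (epsilon_trick0 xpredT C0); apply: lee_nneseries => [//|k _].
have [_] := hW (k * q + a)%N; rewrite -/(F k).
have -> : block_len q (k * q + a) = (2 ^ k)%N by rewrite /block_len divnMDl// divn_small// addn0.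
have rF : rho (F k) \is a fin_num.
  by rewrite ge0_fin_numE// (le_lt_trans _ rhoT)// le_measure ?inE//; exact: mE.
rewrite -(fineK rF) -(fineK rhof) -!EFinM !lee_fin -/C => h.
rewrite ler_pdivlMr ?ltr0n ?expn_gt0// expnS natrM mulrCA ler_pM2l//.
by rewrite mulrC.
Qed.

End Measure.

(** * Borel structure of the set of non-normal numbers *)

Section NonNormal.
Context {R : realType}.

Lemma non_normal0 : ~ normal (0 : R).
Proof.
move=> /normal_excessP/(_ 1 ltr01)[N /(_ N.+1 (leqnSn N))].
have -> : excess (0 : R) N.+1 = - 9 * N.+1%:Z.
  rewrite /excess (eq_bigr (fun=> - 9)) => [|i _]; last first.
    by rewrite /digit mul0r floor0 mod0z mul0r add0r.
  by rewrite sumr_const_nat subSS subn0 -[LHS]mulr_natr [X in _ * X]natz.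
by rewrite -intr_norm mul1r -[N.+1%:R]/(N.+1%:~R) ler_int; lia.
Qed.

(** Empty for inadmissible indices, so that unions can run over all natural numbers. *)
Definition often_biased_pair (q a b : nat) : set R :=
  if [&& (2 < q)%N, (a < q)%N, (b < q)%N & a != b] then
    [set x | often_biased q a x] `&` [set x | often_biased q b x] else set0.

Lemma non_normalE :
  ~` [set x : R | normal x] = \bigcup_q \bigcup_a \bigcup_b often_biased_pair q a b.
Proof.
apply/seteqP; split=> x /=.
  move=> /not_normal_often_biased[q [a [b [q2 aq bq ab h]]]].
  by exists q => //; exists a => //; exists b => //; rewrite /often_biased_pair q2 aq bq ab.
move=> [q _ [a _ [b _]]]; rewrite /often_biased_pair; case: ifP => // /andP[q2 _] [h _].
by apply: often_biased_not_normal h; apply: leq_trans q2.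
Qed.

Lemma measurable_often_biased q a : measurable [set x : R | often_biased q a x].
Proof.
rewrite (_ : [set x | _] = \bigcap_N \bigcup_(j in [set j | (N <= j)%N /\ (j %% q)%N = a])
   [set x | biased_block q x j]).
  apply: bigcapT_measurable => N; apply: bigcup_measurable => j _.
  apply: (@measurable_floor_preimage R [set z | biased q (block_len q j) z]).
  by rewrite exprn_gt0.
apply/seteqP; split=> x /= h N.
  by move=> _; have [j [Nj ja jb]] := h N; exists j.
by have [j [Nj ja] jb] := h N I; exists j.
Qed.

Lemma measurable_often_biased_pair q a b : measurable (often_biased_pair q a b).
Proof.
rewrite /often_biased_pair; case: ifP => // _.
by apply: measurableI; exact: measurable_often_biased.
Qed.

Lemma measurable_non_normal : measurable (~` [set x : R | normal x]).
Proof.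
rewrite non_normalE; apply: bigcupT_measurable => q; apply: bigcupT_measurable => a.
by apply: bigcupT_measurable => b; exact: measurable_often_biased_pair.
Qed.

Lemma translate_often_biased_sub q a (w : nat -> nat) t (A : set R) : (a < q)%N ->
  A `<=` [set x | often_biased q a x] ->
  (forall j y, biased_block q (y - t) j ->
    reach_biased q (block_len q j) (Num.floor (y * 10 ^+ block_start q j.+1)) (w j)) ->
  translate A t `<=` lim_sup_set (fun k => [set y : R | let j := (k * q + a)%N in
    reach_biased q (block_len q j) (Num.floor (y * 10 ^+ block_start q j.+1)) (w j)]).
Proof.
move=> aq hA hw _ [x /hA Ax <-] n _.
have [j [nj ja jb]] := Ax (n * q)%N.
have q0 : (0 < q)%N by apply: leq_ltn_trans aq.
exists (j %/ q)%N => /=; first by rewrite leq_divRL.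
by rewrite -ja -divn_eq; apply: hw; rewrite addrK.
Qed.

(** * Nullity under a translation invariant measure *)

Section Invariant.
Let B : set R := ~` [set x : R | normal x].
Context (S : set (set R)) (mu : {measure set (g_sigma_algebraType S) -> \bar R}).
Context (hS : borel_sigma_algebra S) (hmu : translation_invariant mu).
Context (hB : sigma_finite (B : set (g_sigma_algebraType S)) mu).

Let measurableS (X : set R) : (measurable : set (set R)) X ->
  (measurable : set (set (g_sigma_algebraType S))) X.
Proof. by move=> mX; apply: sub_sigma_algebra; apply: hS.2. Qed.

Let SE : (measurable : set (set (g_sigma_algebraType S))) = S.
Proof. exact: measurable_g_measurableTypeE hS.1. Qed.

(** The condition on b + 1 makes t vanish also in the block after one of index b mod q, so that a
    carry and a borrow cannot both reach the latter. *)
Let biased_pair_null q a b : (2 < q)%N -> (a < q)%N -> (b < q)%N -> a != b ->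
  (b.+1 %% q)%N != a ->
  mu ([set x | often_biased q a x] `&` [set x | often_biased q b x]) = 0%E.
Proof.
move=> q2 aq bq ab b1a; set A := _ `&` _; have q0 : (0 < q)%N by apply: leq_trans q2.
have mA : measurable (A : set (g_sigma_algebraType S)).
  by apply: measurableS; apply: measurableI; exact: measurable_often_biased.
have mB : measurable (B : set (g_sigma_algebraType S)).
  by apply: measurableS; exact: measurable_non_normal.
have mT (X : set R) t : measurable (X : set (g_sigma_algebraType S)) ->
    measurable (translate X t : set (g_sigma_algebraType S)).
  by rewrite SE => /(hmu t)[].
have [rho [rhoT hrho]] := finite_measure_of_sigma_finite hB.
have mid : measurable_fun setT (id : g_sigma_algebraType S -> R).
  by move=> _ Y mY; rewrite setTI; exact: measurableS.
have [w [wlt w0 wnull]] := null_translation_digits mid rhoT aq.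
have [t [h1 h2]] := @shift_exists R q w q0 wlt.
set F := (fun k => _) in wnull.
have mF : measurable (lim_sup_set F).
  have mFk k : measurable (F k).
    apply: measurableS; apply: (@measurable_floor_preimage R
      [set z | reach_biased q (block_len q (k * q + a)) z (w (k * q + a)%N)]).
    by rewrite exprn_gt0.
  by apply: bigcapT_measurable => n; apply: bigcup_measurable.
have FB : mu (lim_sup_set F `&` B) = 0%E by exact: hrho.
(* Translation by s carries A /\ (B - s) into (A + s) /\ B, which lies in the null set
   [lim_sup_set F] /\ B. *)
have null s : translate A s `<=` lim_sup_set F ->
    mu (A `&` translate B (- s)) = 0%E.
  move=> sub; have mAs : measurable (A `&` translate B (- s) : set (g_sigma_algebraType S)).
    by apply: measurableI => //; exact: mT.
  have [_ <-] := hmu s (eq_ind _ (fun M => M _) mAs _ SE).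
  apply/eqP; rewrite -measure_le0 -FB le_measure ?inE//.
  - exact: mT.
  - exact: measurableI.
  - move=> _ [x [Ax [y By yx]] <-]; split; last by rewrite -yx subrK.
    by apply: sub; exists x.
have subA : A `<=` [set x | often_biased q a x] by move=> x [].
have null1 : mu (A `&` translate B (- t)) = 0%E.
  apply: null; apply: (translate_often_biased_sub aq subA) => j y yb.
  by apply: h1; right.
have null2 : mu (A `&` translate B (- - t)) = 0%E.
  apply: null; apply: (translate_often_biased_sub aq subA) => j y; rewrite opprK => yb.
  by apply: h1; left.
apply/eqP; rewrite -measure_le0.
apply: (@le_trans _ _ (mu ((A `&` translate B (- t)) `|` (A `&` translate B (- - t))))).
  rewrite le_measure ?inE//.
    by apply: measurableU; apply: measurableI => //; exact: mT.
  move=> x Ax; rewrite -setIUr; split=> //.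
  suff [/= h|/= h] : B (x + t) \/ B (x - t).
  - by left; exists (x + t) => //; rewrite addrK.
  - by right; exists (x - t) => //; rewrite opprK subrK.
  (* Were x + t and x - t both normal, neither would have biased blocks far out, yet a far biased
     block of x of index b mod q survives in one of them. *)
  apply: contrapT => /not_orP[/contrapT n1 /contrapT n2].
  have [N1 hN1] := normal_not_biased q0 n1; have [N2 hN2] := normal_not_biased q0 n2.
  have [j [Nj jb jbiased]] := Ax.2 (maxn N1 N2).
  move: Nj; rewrite geq_max => /andP[N1j N2j].
  have wj : w j = 0%N by apply: w0; rewrite jb eq_sym.
  have wj1 : w j.+1 = 0%N by apply: w0; rewrite -addn1 -modnDml jb addn1.
  have [hb|hb] := h2 j x wj wj1 jbiased.
    by move/negP: (hN1 j N1j).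
  by move/negP: (hN2 j N2j).
suff : (mu ((A `&` translate B (- t)) `|` (A `&` translate B (- - t))) <=
    mu (A `&` translate B (- t)) + mu (A `&` translate B (- - t)))%E.
  by rewrite null1 null2 adde0.
by apply: measureU2; apply: measurableI => //; exact: mT.
Qed.

Lemma non_normal_null : mu B = 0%E.
Proof.
apply: measure_negligible; first by apply: measurableS; exact: measurable_non_normal.
rewrite /B non_normalE; apply: negligible_bigcup => q; apply: negligible_bigcup => a.
apply: negligible_bigcup => b; apply/negligibleP.
  by apply: measurableS; exact: measurable_often_biased_pair.
rewrite /often_biased_pair; case: ifP => [/and4P[q2 aq bq ab]|_]; last exact: measure0.
(* Since q > 2, not both b + 1 = a and a + 1 = b hold mod q. *)
have [b1a|b1a] := eqVneq (b.+1 %% q)%N a; last exact: biased_pair_null.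
rewrite setIC; apply: biased_pair_null => //; first by rewrite eq_sym.
apply/eqP => a1b.
have : (b.+2 = b %[mod q])%N.
  by rewrite -addn1 -modnDml b1a addn1 a1b modn_small.
move=> /eqP; rewrite -addn2 -{2}[b]addn0 eqn_modDl mod0n modn_small//.
Qed.

End Invariant.
End NonNormal.

Theorem theorem2p3 (R : realType) :
  immeasurable (~` [set x : R | normal x]).
Proof.
split; [by exists 0; exact: non_normal0 | exact: measurable_non_normal |].
move=> S mu hS hmu; have [hB|hB] := pselect (sigma_finite
  (~` [set x : R | normal x] : set (g_sigma_algebraType S)) mu); last by right.
by left; exact: non_normal_null.
Qed.
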